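(* Let $R_1,\dots,R_m$ ($m\geq 1$) be a finite family of commutative rings with identity, each of finite Gorenstein global dimension. Then $\mathcal{SGP}\left(\prod_{i=1}^m R_i\right)=\mathcal{GP}\left(\prod_{i=1}^m R_i\right)$ if and only if $\mathcal{SGP}(R_i)=\mathcal{GP}(R_i)$ for each $i=1,\dots,m$.
   Context: All rings are commutative with identity and all modules are unital. For a ring $R$, $\mathcal{GP}(R)$ denotes the class of all Gorenstein projective $R$-modules and $\mathcal{SGP}(R)$ the class of all strongly Gorenstein projective $R$-modules. An $R$-module $M$ is Gorenstein projective if there is an exact complex of projective $R$-modules $\mathbf{P}=\cdots\to P_1\to P_0\to P_{-1}\to\cdots$ with $M\cong \mathrm{Im}(P_0\to P_{-1})$ such that $\mathrm{Hom}_R(\mathbf{P},Q)$ is exact for every projective $R$-module $Q$. An $R$-module $M$ is strongly Gorenstein projective if there is an exact sequence $\mathbf{P}=\cdots\to P\xrightarrow{f}P\xrightarrow{f}P\xrightarrow{f}P\to\cdots$ in which all modules are the same projective $R$-module $P$ and all maps are the same map $f$, such that $M\cong\mathrm{Im}(f)$ and $\mathrm{Hom}_R(\mathbf{P},Q)$ is exact for every projective $R$-module $Q$. The Gorenstein projective dimension $\mathrm{Gpd}_R(M)$ is the least integer $n\geq 0$ for which there is an exact sequence $0\to G_n\to\cdots\to G_0\to M\to 0$ with all $G_i$ Gorenstein projective ($\infty$ if no such $n$ exists). The Gorenstein global dimension of $R$ is $\mathrm{G.gldim}(R)=\sup\{\mathrm{Gpd}_R(M)\mid M \text{ an } R\text{-module}\}$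 (it is known that this equals the analogous supremum of Gorenstein injective dimensions). *)

(* Defs.v *)
From HB Require Import structures.
From mathcomp Require Import all_boot all_order all_algebra.

Set Implicit Arguments.
Unset Strict Implicit.
Unset Printing Implicit Defensive.

Import GRing.Theory.
Local Open Scope ring_scope.

(* Finite product of commutative rings, with componentwise operations. The Pz
   structures are used throughout, so that zero rings are allowed. *)
Definition prod_ring (I : finType) (R : I -> comPzRingType) : Type :=
  {dffun forall i : I, R i}.

Section ProdRing.
Variables (I : finType) (R : I -> comPzRingType).
Implicit Types x y z : prod_ring R.

HB.instance Definition _ :=
  Choice.copy (prod_ring R) {dffun forall i : I, R i}.

Definition prod_zero : prod_ring R := [ffun i => 0 : R i].
Definition prod_one : prod_ring R := [ffun i => 1 : R i].
Definition prod_opp x : prod_ring R := [ffun i => - x i].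
Definition prod_add x y : prod_ring R := [ffun i => x i + y i].
Definition prod_mul x y : prod_ring R := [ffun i => x i * y i].

Fact prod_addA : associative prod_add.
Proof. by move=> x y z; apply/ffunP=> i; rewrite !ffunE addrA. Qed.
Fact prod_addC : commutative prod_add.
Proof. by move=> x y; apply/ffunP=> i; rewrite !ffunE addrC. Qed.
Fact prod_add0 : left_id prod_zero prod_add.
Proof. by move=> x; apply/ffunP=> i; rewrite !ffunE add0r. Qed.
Fact prod_addN : left_inverse prod_zero prod_opp prod_add.
Proof. by move=> x; apply/ffunP=> i; rewrite !ffunE addNr. Qed.

HB.instance Definition _ := GRing.isZmodule.Build (prod_ring R)
  prod_addA prod_addC prod_add0 prod_addN.

Fact prod_mulA : associative prod_mul.
Proof. by move=> x y z; apply/ffunP=> i; rewrite !ffunE mulrA. Qed.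
Fact prod_mulC : commutative prod_mul.
Proof. by move=> x y; apply/ffunP=> i; rewrite !ffunE mulrC. Qed.
Fact prod_mul1 : left_id prod_one prod_mul.
Proof. by move=> x; apply/ffunP=> i; rewrite !ffunE mul1r. Qed.
Fact prod_mulDl : left_distributive prod_mul prod_add.
Proof. by move=> x y z; apply/ffunP=> i; rewrite !ffunE mulrDl. Qed.

HB.instance Definition _ := GRing.Zmodule_isComPzRing.Build (prod_ring R)
  prod_mulA prod_mulC prod_mul1 prod_mulDl.

End ProdRing.

Section Gorenstein.
Variable R : comPzRingType.
Implicit Types M N L P Q : lmodType R.

Definition is_projective P : Prop :=
  forall M N (g : {linear M -> N}) (f : {linear P -> N}),
    (forall y : N, exists x : M, g x = y) ->
    exists h : {linear P -> M}, forall x, g (h x) = f x.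

(* Exactness of L --f--> M --g--> N at M, that is ker g = im f. *)
Definition exact_at L M N (f : L -> M) (g : M -> N) : Prop :=
  forall y : M, g y = 0 <-> exists x : L, f x = y.

(* Two-sided complexes are graded homologically, d n : P_n -> P_(n-1); since
   n ranges over all of int, exactness at the P_(n-1) is exactness everywhere. *)
Definition exact_complex (P : int -> lmodType R)
    (d : forall n, {linear P n -> P (n - 1)}) : Prop :=
  forall n, exact_at (d n) (d (n - 1)).

(* Exactness of Hom_R(P, Q): the sequence
   Hom(P_(n-2), Q) -> Hom(P_(n-1), Q) -> Hom(P_n, Q)
   given by precomposition is exact at the middle term for every n. *)
Definition hom_exact (P : int -> lmodType R)
    (d : forall n, {linear P n -> P (n - 1)}) Q : Prop :=
  forall n (f : {linear P (n - 1) -> Q}),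
    (forall x, f (d n x) = 0) <->
    exists g : {linear P (n - 1 - 1) -> Q}, forall x, g (d (n - 1) x) = f x.

(* M is isomorphic to Im f: an isomorphism onto the submodule Im f of P is the
   same thing as an injective linear map to P whose range is Im f. *)
Definition iso_im M L P (f : {linear L -> P}) : Prop :=
  exists j : {linear M -> P}, injective j /\
    forall y : P, (exists x, j x = y) <-> (exists x, f x = y).

Definition Gorenstein_projective M : Prop :=
  exists (P : int -> lmodType R) (d : forall n, {linear P n -> P (n - 1)}),
    [/\ forall n, is_projective (P n),
        exact_complex d,
        iso_im M (d 0)
      & forall Q, is_projective Q -> hom_exact d Q].

Definition strongly_Gorenstein_projective M : Prop :=
  exists (P : lmodType R) (f : {linear P -> P}),
    [/\ is_projective P,
        @exact_complex (fun=> P) (fun=> f),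
        iso_im M f
      & forall Q, is_projective Q -> @hom_exact (fun=> P) (fun=> f) Q].

(* SGP(R) = GP(R), as an equality of classes of R-modules. *)
Definition SGP_eq_GP : Prop :=
  forall M, strongly_Gorenstein_projective M <-> Gorenstein_projective M.

(* Existence of an exact sequence 0 -> G_n -> ... -> G_0 -> M -> 0 with all
   G_i Gorenstein projective; the sequence is continued by zero modules in
   degrees > n, so that exactness at G_n says that G_n -> G_(n-1) (or e, when
   n = 0) is injective. *)
Definition has_GP_resolution M (n : nat) : Prop :=
  exists (G : nat -> lmodType R) (d : forall i, {linear G i.+1 -> G i})
         (e : {linear G 0%N -> M}),
    [/\ forall i, (i <= n)%N -> Gorenstein_projective (G i),
        forall i, (n < i)%N -> forall x : G i, x = 0,
        forall y : M, exists x, e x = y,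
        exact_at (d 0%N) e
      & forall i, exact_at (d i.+1) (d i)].

Definition is_least (A : nat -> Prop) (n : nat) : Prop :=
  A n /\ forall k, A k -> (n <= k)%N.

(* Gpd_R(M) and G.gldim(R) take values in nat with infinity adjoined; they are
   given here by the relations "is finite and equal to n". *)
Definition Gpd_eq M (n : nat) : Prop := is_least (has_GP_resolution M) n.

Definition Gpd_le M (n : nat) : Prop :=
  exists2 k : nat, Gpd_eq M k & (k <= n)%N.

Definition Ggldim_eq (n : nat) : Prop :=
  is_least (fun b => forall M, Gpd_le M b) n.

Definition finite_Ggldim : Prop := exists n, Ggldim_eq n.

End Gorenstein.

Arguments SGP_eq_GP R : clear implicits.
Arguments finite_Ggldim R : clear implicits.

(* Main.v *)
From HB Require Import structures.
Require Import Defs.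
From mathcomp Require Import all_boot all_order all_algebra.

(** Write S for the product of the rings R i and e_i for its idempotents.
   Splitting along the e_i makes an S-module M the same thing as the family of
   its components e_i M, each a module over R i, and every ingredient of
   Gorenstein projectivity can be tested component by component.

   Two functors carry the argument: [component_functor], which sends an
   S-module M to the R i-module e_i M, and [inflation_functor], which lets S
   act on an R i-module through the i-th projection.  Since R i is both a
   quotient and a direct factor of S, they are adjoint to each other on both
   sides, and both are exact.  A left adjoint of an exact functor preserves
   projectivity, and for biadjoint F and G the isomorphism
   Hom(F P, Q) = Hom(P, G Q), with G Q projective, shows that F also preserves
   exactness of Hom(-, Q).  Hence both functors turn complete projective
   resolutions into complete projective resolutions, and those with constant
   modules and differential into such; so they preserve both classes GP and SGP
   ([biadjoint_GP], [biadjoint_SGP]).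

   If SGP = GP over S and N is Gorenstein projective over R i, then the
   inflation of N is Gorenstein projective over S, hence strongly so, and N is
   isomorphic to the i-th component of its inflation.

   Conversely, suppose that SGP = GP over every R i and that M is Gorenstein
   projective over S.  Each component of M is strongly Gorenstein projective, so
   its inflation is, and M is the direct sum of these inflations
   ([decomposition_SGP]).  A finite direct sum of strongly Gorenstein projective
   modules is again one: the differentials are added up ([dsum_SGP]). *)

Set Implicit Arguments.
Unset Strict Implicit.
Unset Printing Implicit Defensive.

Import GRing.Theory.

Local Open Scope ring_scope.

(** * Complete resolutions *)

Section Modules.
Variable R : comPzRingType.
Implicit Types M N P Q : lmodType R.

Definition mk_linear M N (f : M -> N) (lf : linear f) : {linear M -> N} :=
  HB.pack f (GRing.isLinear.Build R M N *:%R f lf).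

(** The part of the definitions of GP and SGP that concerns the complex alone,
   so that a constant complex can be treated as an instance of a general one. *)
Definition complete (P : int -> lmodType R)
    (d : forall n, {linear P n -> P (n - 1)}) : Prop :=
  [/\ forall n, is_projective (P n), exact_complex d
    & forall Q, is_projective Q -> hom_exact d Q].

Lemma SGP_GP M : strongly_Gorenstein_projective M -> Gorenstein_projective M.
Proof.
move=> [P [f [projP exf imf homf]]].
by exists (fun=> P), (fun=> f).
Qed.

Lemma SGP_of_iso M N (h : {linear M -> N}) :
    injective h -> (forall y, exists x, h x = y) ->
  strongly_Gorenstein_projective N -> strongly_Gorenstein_projective M.
Proof.
move=> h_inj h_surj [P [f [projP exf [j [j_inj imj]] homf]]].
exists P, f; split=> //; exists (j \o h); split; first exact: inj_comp.
move=> y; split=> [[x /= <-]|/imj[z <-]]; first by apply/imj; exists (h x).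
by have [x <-] := h_surj z; exists x.
Qed.

End Modules.

(** * Functors compatible with the underlying sets *)

(** A functor F such that, on underlying groups, F M is a natural retract of M:
   it is a direct summand of M when F cuts out the part fixed by an idempotent,
   and M itself when F restricts scalars.  The maps [incl] and [retr] live over
   different rings, hence are only additive.  This packaging makes exactness of
   F automatic and lets both examples share all proofs below. *)
Record carrier_functor (A B : comPzRingType) := CarrierFunctor {
  fobj :> lmodType A -> lmodType B;
  fmap : forall M N : lmodType A, {linear M -> N} -> {linear fobj M -> fobj N};
  incl : forall M : lmodType A, {additive fobj M -> M};
  retr : forall M : lmodType A, {additive M -> fobj M};
  inclK : forall M : lmodType A, cancel (@incl M) (@retr M);
  incl_map : forall (M N : lmodType A) (f : {linear M -> N}) y,
    incl N (fmap f y) = f (incl M y);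
  retr_map : forall (M N : lmodType A) (f : {linear M -> N}) x,
    fmap f (retr M x) = retr N (f x)
}.
Arguments fmap {A B} F {M N} f : rename.
Arguments incl {A B} F {M} : rename.
Arguments retr {A B} F {M} : rename.

Section Adjunction.
Variables (A B : comPzRingType) (F : carrier_functor A B) (G : carrier_functor B A).

(** Exactness is a statement about underlying groups, and it passes to natural
   retracts: move an element to M by [incl], solve there, come back by [retr]. *)
Lemma carrier_functor_exact (L M N : lmodType A) (f : {linear L -> M})
    (g : {linear M -> N}) :
  exact_at f g -> exact_at (fmap F f) (fmap F g).
Proof.
move=> exfg y; split=> [gy0|[x <-]].
  have /exfg [x fx] : g (incl F y) = 0 by rewrite -incl_map gy0 raddf0.
  by exists (retr F x); rewrite retr_map fx inclK.
apply: (can_inj (@inclK _ _ F N)).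
by rewrite !incl_map raddf0; apply/exfg; exists (incl F x).
Qed.

Lemma carrier_functor_iso_im (L M N : lmodType A) (f : {linear L -> N}) :
  iso_im M f -> iso_im (F M) (fmap F f).
Proof.
move=> [j [j_inj imj]]; exists (fmap F j); split=> [x y /(congr1 (incl F))|y].
  by rewrite !incl_map => /j_inj /(can_inj (@inclK _ _ F M)).
have im_sub (K K' : lmodType A) (k : {linear K -> N}) (k' : {linear K' -> N}) :
    (forall z, (exists x, k x = z) -> exists x, k' x = z) ->
    (exists x, fmap F k x = y) -> exists x, fmap F k' x = y.
  move=> sub [x kx].
  have [|x' k'x'] := sub (incl F y); first by exists (incl F x); rewrite -kx incl_map.
  by exists (retr F x'); rewrite retr_map k'x' inclK.
by split; apply: im_sub => z /imj.
Qed.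

(** F is left adjoint to G, in the form where the transpose of a map is the map
   itself surrounded by [incl] and [retr].  The first two conditions say that
   these transposes are linear over the right ring; the third says that
   transposing back and forth is the identity on Hom(F M, N), which is a
   condition because [retr] followed by [incl] is in general only an
   idempotent. *)
Definition adjoint : Prop :=
  [/\ forall (M : lmodType A) (N : lmodType B) (f : {linear F M -> N}),
        exists f' : {linear M -> G N}, forall x, f' x = retr G (f (retr F x)),
      forall (M : lmodType A) (N : lmodType B) (h : {linear M -> G N}),
        exists h' : {linear F M -> N}, forall x, h' x = incl G (h (incl F x))
    & forall (M : lmodType A) (N : lmodType B) (f : {linear F M -> N}) x,
        incl G (retr G (f x)) = f x].

(** G is exact, so a lifting problem for F P transposes to one for P. *)
Lemma left_adjoint_projective (P : lmodType A) :
  adjoint -> is_projective P -> is_projective (F P).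
Proof.
move=> [tr rt trK] projP M N g f g_surj.
have [f' f'E] := tr _ _ f.
have [y|h' h'E] := projP _ _ (fmap G g) f'.
  have [x gx] := g_surj (incl G y).
  by exists (retr G x); rewrite retr_map gx inclK.
have [h hE] := rt _ _ h'.
by exists h => x; rewrite hE -incl_map h'E f'E inclK trK.
Qed.

(** For Q projective over B, a map F P_(n-1) -> Q killed by the differential has a
   transpose P_(n-1) -> G Q killed by the differential; as G Q is projective,
   it extends, and the transpose of the extension extends the given map. *)
Lemma left_adjoint_complete (P : int -> lmodType A)
    (d : forall n, {linear P n -> P (n - 1)}) :
  adjoint -> (forall Q, is_projective Q -> is_projective (G Q)) ->
  complete d -> complete (P := fun n => F (P n)) (fun n => fmap F (d n)).
Proof.
move=> adjFG projG [projP exd homd]; split=> [n|n|Q projQ n f].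
- exact: left_adjoint_projective.
- exact: carrier_functor_exact.
split=> [fd0|[g gE] x]; last first.
  have : fmap F (d (n - 1)) (fmap F (d n) x) = 0.
    by apply/(carrier_functor_exact (exd n)); exists x.
  by rewrite -gE => ->; rewrite raddf0.
have [tr rt trK] := adjFG.
have [f' f'E] := tr _ _ f.
have [|g' g'E] := (homd _ (projG _ projQ) n f').1.
  by move=> x; rewrite f'E -(retr_map F (d n)) fd0 raddf0.
have [g gE] := rt _ _ g'; exists g => x.
by rewrite gE incl_map g'E f'E inclK trK.
Qed.

End Adjunction.

Section BiAdjunction.
Variables (A B : comPzRingType) (F : carrier_functor A B) (G : carrier_functor B A).
Hypotheses (adjFG : adjoint F G) (adjGF : adjoint G F).

Lemma biadjoint_complete (P : int -> lmodType A)
    (d : forall n, {linear P n -> P (n - 1)}) :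
  complete d -> complete (P := fun n => F (P n)) (fun n => fmap F (d n)).
Proof.
apply: (left_adjoint_complete adjFG) => Q.
exact: (left_adjoint_projective adjGF).
Qed.

Lemma biadjoint_GP (M : lmodType A) :
  Gorenstein_projective M -> Gorenstein_projective (F M).
Proof.
move=> [P [d [projP exd imd homd]]].
have [projFP exFd homFd] := biadjoint_complete (And3 projP exd homd).
exists (fun n => F (P n)), (fun n => fmap F (d n)); split=> //.
exact: carrier_functor_iso_im.
Qed.

Lemma biadjoint_SGP (M : lmodType A) :
  strongly_Gorenstein_projective M -> strongly_Gorenstein_projective (F M).
Proof.
move=> [P [f [projP exf imf homf]]].
have [] := @biadjoint_complete (fun=> P) (fun=> f).
  by split=> // n; apply: projP.
move=> /(_ 0) projFP exFf homFf.
exists (F P), (fmap F f); split=> //.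
exact: carrier_functor_iso_im.
Qed.

End BiAdjunction.

(** * Finite direct sums of modules *)

Section DirectSum.
Variables (R : comPzRingType) (I : finType).

Definition dsum (V : I -> lmodType R) : Type := {dffun forall i, V i}.

Section Structure.
Variable V : I -> lmodType R.
Implicit Types x y z : dsum V.

HB.instance Definition _ := Choice.copy (dsum V) {dffun forall i, V i}.

Definition dsum_zero : dsum V := [ffun i => 0 : V i].
Definition dsum_opp x : dsum V := [ffun i => - x i].
Definition dsum_add x y : dsum V := [ffun i => x i + y i].
Definition dsum_scale (a : R) x : dsum V := [ffun i => a *: x i].

Fact dsum_addA : associative dsum_add.
Proof. by move=> x y z; apply/ffunP=> i; rewrite !ffunE addrA. Qed.
Fact dsum_addC : commutative dsum_add.
Proof. by move=> x y; apply/ffunP=> i; rewrite !ffunE addrC. Qed.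
Fact dsum_add0 : left_id dsum_zero dsum_add.
Proof. by move=> x; apply/ffunP=> i; rewrite !ffunE add0r. Qed.
Fact dsum_addN : left_inverse dsum_zero dsum_opp dsum_add.
Proof. by move=> x; apply/ffunP=> i; rewrite !ffunE addNr. Qed.

HB.instance Definition _ := GRing.isZmodule.Build (dsum V)
  dsum_addA dsum_addC dsum_add0 dsum_addN.

Fact dsum_scaleA a b x : dsum_scale a (dsum_scale b x) = dsum_scale (a * b) x.
Proof. by apply/ffunP=> i; rewrite !ffunE scalerA. Qed.
Fact dsum_scale1 : left_id 1 dsum_scale.
Proof. by move=> x; apply/ffunP=> i; rewrite !ffunE scale1r. Qed.
Fact dsum_scaleDr : right_distributive dsum_scale +%R.
Proof. by move=> a x y; apply/ffunP=> i; rewrite !ffunE scalerDr. Qed.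
Fact dsum_scaleDl x a b : dsum_scale (a + b) x = dsum_scale a x + dsum_scale b x.
Proof. by apply/ffunP=> i; rewrite !ffunE scalerDl. Qed.

HB.instance Definition _ := GRing.Zmodule_isLmodule.Build R (dsum V)
  dsum_scaleA dsum_scale1 dsum_scaleDr dsum_scaleDl.

Fact dsum_coord_linear i : linear (fun x : dsum V => x i).
Proof. by move=> a x y; rewrite !ffunE. Qed.

Definition dsum_coord i : {linear dsum V -> V i} :=
  mk_linear (@dsum_coord_linear i).

Fact dsum_inj_linear i :
  linear (fun v : V i => finfun (dfwith (fun j => 0 : V j) v) : dsum V).
Proof.
move=> a v w; apply/ffunP=> j; rewrite !ffunE.
have [<-|neq_ij] := eqVneq i j; first by rewrite !dfwith_in.
by rewrite !dfwith_out // scaler0 addr0.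
Qed.

Definition dsum_inj i : {linear V i -> dsum V} := mk_linear (@dsum_inj_linear i).

Lemma dsum_inj_in i v : dsum_inj i v i = v.
Proof. by rewrite ffunE dfwith_in. Qed.

Lemma dsum_inj_out i j v : i != j -> dsum_inj i v j = 0.
Proof. by move=> neq_ij; rewrite ffunE dfwith_out. Qed.

Lemma dsum_sum_inj x : \sum_i dsum_inj i (x i) = x.
Proof.
apply/ffunP=> j; rewrite -[LHS]/(dsum_coord j _) raddf_sum (bigD1 j) //=.
rewrite dsum_inj_in big1 ?addr0 // => i neq_ij; exact: dsum_inj_out.
Qed.

(** Universal property of the direct sum: maps out of it are glued from maps on
   the summands. *)
Lemma dsum_elim (N : lmodType R) (h : forall i, {linear V i -> N}) :
  exists g : {linear dsum V -> N}, forall x, g x = \sum_i h i (x i).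
Proof.
have lg : linear (fun x : dsum V => \sum_i h i (x i)).
  move=> a x y; rewrite scaler_sumr -big_split /=.
  by apply: eq_bigr => i _; rewrite !ffunE linearP.
by exists (mk_linear lg).
Qed.

End Structure.

Section Map.
Variables (V W : I -> lmodType R) (f : forall i, {linear V i -> W i}).

Fact dsum_map_linear : linear (fun x : dsum V => [ffun i => f i (x i)] : dsum W).
Proof. by move=> a x y; apply/ffunP=> i; rewrite !ffunE linearP. Qed.

Definition dsum_map : {linear dsum V -> dsum W} := mk_linear dsum_map_linear.

Lemma dsum_mapE x i : dsum_map x i = f i (x i).
Proof. by rewrite ffunE. Qed.

Lemma dsum_map_inj i v : dsum_map (dsum_inj V i v) = dsum_inj W i (f i v).
Proof.
apply/ffunP=> j; rewrite dsum_mapE.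
have [<-|neq_ij] := eqVneq i j; first by rewrite !dsum_inj_in.
by rewrite !dsum_inj_out ?raddf0.
Qed.

(** Preimages are chosen one summand at a time; finiteness of the index type
   makes this possible without the axiom of choice. *)
Lemma dsum_map_im (y : dsum W) :
  (exists x, dsum_map x = y) <-> (forall i, exists v, f i v = y i).
Proof.
split=> [[x <-] i|/fin_all_exists [x fx]]; first by exists (x i); rewrite dsum_mapE.
exists (finfun x : dsum V); apply/ffunP=> i.
rewrite dsum_mapE ffunE; exact: fx.
Qed.

End Map.

Lemma dsum_projective (P : I -> lmodType R) :
  (forall i, is_projective (P i)) -> is_projective (dsum P).
Proof.
move=> projP M N g f g_surj.
have /fin_all_exists [h hE] i :
    exists h : {linear P i -> M}, forall v, g (h v) = f (dsum_inj P i v).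
  exact: (projP i _ _ g (f \o dsum_inj P i)).
have [k kE] := dsum_elim h; exists k => x.
rewrite kE raddf_sum -[in RHS](dsum_sum_inj x) raddf_sum.
by apply: eq_bigr => i _; exact: hE.
Qed.

Lemma dsum_exact (L M N : I -> lmodType R) (f : forall i, {linear L i -> M i})
    (g : forall i, {linear M i -> N i}) :
  (forall i, exact_at (f i) (g i)) -> exact_at (dsum_map f) (dsum_map g).
Proof.
move=> exfg y; split=> [gy0|/dsum_map_im fy].
  by apply/dsum_map_im => i; apply/exfg; rewrite -dsum_mapE gy0 ffunE.
by apply/ffunP=> i; rewrite dsum_mapE ffunE; apply/exfg; exact: fy.
Qed.

(** Given (P_i, f_i) for each summand, the sum of the P_i with the sum of the f_i
   works: exactness and images are computed summandwise, and an extension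
   problem for a map into Q is solved on each summand and glued. *)
Lemma dsum_SGP (M : I -> lmodType R) :
  (forall i, strongly_Gorenstein_projective (M i)) ->
  strongly_Gorenstein_projective (dsum M).
Proof.
move=> /fin_all_exists [P /fin_all_exists [f Pf]].
have exf : exact_at (dsum_map f) (dsum_map f).
  by apply: dsum_exact => i; have [_ exfi _ _] := Pf i; apply: (exfi 0).
exists (dsum P), (dsum_map f); split=> [|//||Q projQ _ k].
- by apply: dsum_projective => i; have [] := Pf i.
- have /fin_all_exists [j jP] i : exists j : {linear M i -> P i}, injective j /\
    forall y, (exists x, j x = y) <-> (exists x, f i x = y).
    by have [] := Pf i.
  exists (dsum_map j); split=> [x y jxy|y].
    by apply/ffunP=> i; apply: (jP i).1; rewrite -!dsum_mapE jxy.
  by split=> /dsum_map_im im_y; apply/dsum_map_im => i; apply/(jP i).2.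
split=> [kf0|[g gE] x]; last first.
  have : dsum_map f (dsum_map f x) = 0 by apply/exf; exists x.
  by rewrite -gE => ->; rewrite raddf0.
have /fin_all_exists [g gE] i :
    exists g : {linear P i -> Q}, forall v, g (f i v) = k (dsum_inj P i v).
  have [_ _ _ homf] := Pf i.
  apply: ((homf Q projQ 0 (k \o dsum_inj P i)).1 _) => v /=.
  by have := kf0 (dsum_inj P i v); rewrite dsum_map_inj.
have [h hE] := dsum_elim g; exists h => x.
rewrite hE -[in RHS](dsum_sum_inj x) raddf_sum.
by apply: eq_bigr => i _; rewrite dsum_mapE gE.
Qed.

End DirectSum.

(** * The two functors attached to a factor of a product ring *)

Section Component.
Variables (I : finType) (R : I -> comPzRingType) (i : I).
Local Notation S := (prod_ring R).

(** The embedding of the factor R i as an ideal of the product; it respects sums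
   and products but sends 1 to the idempotent e_i below. *)
Definition factor_inj (a : R i) : S := finfun (dfwith (fun j => 0 : R j) a).

Lemma factor_injE a : factor_inj a i = a.
Proof. by rewrite ffunE dfwith_in. Qed.

Lemma mul_factor_inj (s : S) a : s * factor_inj a = factor_inj (s i * a).
Proof.
apply/ffunP=> j; rewrite !ffunE.
have [<-|neq_ij] := eqVneq i j; first by rewrite !dfwith_in.
by rewrite !dfwith_out // mulr0.
Qed.

Lemma factor_injM a b : factor_inj (a * b) = factor_inj a * factor_inj b.
Proof. by rewrite mul_factor_inj factor_injE. Qed.

Lemma factor_injD a b : factor_inj (a + b) = factor_inj a + factor_inj b.
Proof.
apply/ffunP=> j; rewrite !ffunE.
have [<-|neq_ij] := eqVneq i j; first by rewrite !dfwith_in.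
by rewrite !dfwith_out // addr0.
Qed.

Definition factor_idem : S := factor_inj 1.
Local Notation e := factor_idem.

Lemma mul_factor_idem s : s * e = factor_inj (s i).
Proof. by rewrite mul_factor_inj mulr1. Qed.

Lemma idem_factor_inj a : e * factor_inj a = factor_inj a.
Proof. by rewrite -factor_injM mul1r. Qed.

(** The restriction of scalars of N along the projection onto the i-th factor. *)
Definition inflation (N : lmodType (R i)) : Type := N.

Section InflationStructure.
Variable N : lmodType (R i).

HB.instance Definition _ := GRing.Zmodule.copy (inflation N) N.

Definition inflation_scale (s : S) (x : inflation N) : inflation N := s i *: (x : N).

Fact inflation_scaleA s t x :
  inflation_scale s (inflation_scale t x) = inflation_scale (s * t) x.
Proof. by rewrite /inflation_scale scalerA ffunE. Qed.
Fact inflation_scale1 : left_id 1 inflation_scale.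
Proof. by move=> x; rewrite /inflation_scale ffunE scale1r. Qed.
Fact inflation_scaleDr : right_distributive inflation_scale +%R.
Proof. by move=> s x y; apply: scalerDr. Qed.
Fact inflation_scaleDl x s t :
  inflation_scale (s + t) x = inflation_scale s x + inflation_scale t x.
Proof. by rewrite /inflation_scale ffunE scalerDl. Qed.

HB.instance Definition _ := GRing.Zmodule_isLmodule.Build S (inflation N)
  inflation_scaleA inflation_scale1 inflation_scaleDr inflation_scaleDl.

Lemma inflation_scaleE (s : S) (x : inflation N) : s *: x = s i *: (x : N) :> N.
Proof. by []. Qed.

End InflationStructure.

Fact inflation_map_linear (N N' : lmodType (R i)) (f : {linear N -> N'}) :
  linear (f : inflation N -> inflation N').
Proof. by move=> s x y; rewrite -[LHS]/(f (s i *: (x : N) + y)) linearP. Qed.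

Definition inflation_functor : carrier_functor (R i) S.
Proof.
exists (fun N => inflation N) (fun _ _ f => mk_linear (inflation_map_linear f))
  (fun N => @idfun N : {additive N -> N}) (fun N => @idfun N : {additive N -> N}) => //.
Defined.

Definition idem_fixed (M : lmodType S) : {pred M} := fun x => e *: x == x.

Section ComponentStructure.
Variable M : lmodType S.

Fact idem_fixed_zmod_closed : zmod_closed (@idem_fixed M).
Proof.
split=> [|x y]; rewrite !unfold_in /= ?scaler0 // => /eqP ex /eqP ey.
by rewrite scalerBr ex ey.
Qed.
HB.instance Definition _ := GRing.isZmodClosed.Build M (@idem_fixed M) idem_fixed_zmod_closed.

(** The R i-module e_i M, encoded as the elements on which e_i acts trivially;
   a scalar of R i acts through its image under [factor_inj]. *)
Definition component : Type := {x : M | x \in @idem_fixed M}.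
HB.instance Definition _ := SubChoice.on component.
HB.instance Definition _ := [SubChoice_isSubZmodule of component by <:].

Lemma componentP (x : component) : e *: val x = val x.
Proof. exact/eqP/(valP x). Qed.

Fact factor_inj_fixed a (x : M) : factor_inj a *: x \in @idem_fixed M.
Proof. by rewrite unfold_in /= scalerA idem_factor_inj. Qed.

Definition component_scale a (x : component) : component :=
  Sub (factor_inj a *: val x) (factor_inj_fixed a (val x)).

Fact component_scaleA a b x :
  component_scale a (component_scale b x) = component_scale (a * b) x.
Proof. by apply: val_inj; rewrite /= scalerA factor_injM. Qed.
Fact component_scale1 : left_id 1 component_scale.
Proof. by move=> x; apply: val_inj; rewrite /= componentP. Qed.
Fact component_scaleDr : right_distributive component_scale +%R.
Proof. by move=> a x y; apply: val_inj; rewrite /= scalerDr. Qed.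
Fact component_scaleDl x a b :
  component_scale (a + b) x = component_scale a x + component_scale b x.
Proof. by apply: val_inj; rewrite /= factor_injD scalerDl. Qed.

HB.instance Definition _ := GRing.Zmodule_isLmodule.Build (R i) component
  component_scaleA component_scale1 component_scaleDr component_scaleDl.

Lemma val_componentZ a (x : component) : val (a *: x) = factor_inj a *: val x.
Proof. by []. Qed.

Definition component_proj (x : M) : component :=
  Sub (e *: x) (factor_inj_fixed 1 x).

Fact component_proj_additive : zmod_morphism component_proj.
Proof. by move=> x y; apply: val_inj; rewrite /= scalerBr. Qed.
HB.instance Definition _ :=
  GRing.isZmodMorphism.Build M component component_proj component_proj_additive.

(** Semilinearity of x |-> e_i x over the projection onto the i-th factor: this is
   what makes transposes through [component_proj] linear. *)
Lemma component_projZ s x : component_proj (s *: x) = s i *: component_proj x.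
Proof.
apply: val_inj; rewrite val_componentZ /= !scalerA.
by rewrite ![e * _]mulrC !mul_factor_idem factor_injE.
Qed.

End ComponentStructure.

Section ComponentMap.
Variables (M M' : lmodType S) (f : {linear M -> M'}).

Fact component_map_fixed (x : component M) : f (val x) \in @idem_fixed M'.
Proof. by rewrite unfold_in -linearZ componentP. Qed.

Definition component_map (x : component M) : component M' :=
  Sub (f (val x)) (component_map_fixed x).

Fact component_map_linear : linear component_map.
Proof. by move=> a x y; apply: val_inj; rewrite /= linearP. Qed.

End ComponentMap.

Definition component_functor : carrier_functor S (R i).
Proof.
exists (fun M => component M) (fun _ _ f => mk_linear (component_map_linear f))
  (fun M : lmodType S => val : {additive component M -> M})
  (fun M : lmodType S => @component_proj M : {additive M -> component M}).
- by move=> M x; apply: val_inj; rewrite /= componentP.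
- by [].
- by move=> M N f x; apply: val_inj; rewrite /= linearZ.
Defined.

(** An S-linear map from M to an inflated module kills (1 - e_i) M, since e_i acts
   as the identity on its target; so it is determined by its values on e_i M. *)
Lemma component_inflation_adjoint : adjoint component_functor inflation_functor.
Proof.
split=> [M N f|M N h|//].
- have lf : linear (fun x : M => f (component_proj x) : inflation N).
    by move=> s x y; rewrite raddfD /= component_projZ linearP.
  by exists (mk_linear lf).
have lh : linear (fun x : component M => h (val x) : N).
  move=> a x y; rewrite -[LHS]/(h (factor_inj a *: val x + val y)).
  by rewrite linearP inflation_scaleE factor_injE.
by exists (mk_linear lh).
Qed.

(** An S-linear map out of an inflated module has all its values in e_i M, since
   e_i acts as the identity on its source. *)
Lemma inflation_component_adjoint : adjoint inflation_functor component_functor.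
Proof.
split=> [N M f|N M h|N M f x] /=.
- have lf : linear (fun x : N => component_proj (f x)).
    (* In the inflation, a acts as any element of S with i-th coordinate a. *)
    move=> a x y; rewrite -{1}[a]factor_injE.
    rewrite -[_ *: x]/(factor_inj a *: (x : inflation N)).
    by rewrite linearP raddfD /= component_projZ factor_injE.
  by exists (mk_linear lf).
- have lh : linear (fun x : inflation N => val (h x) : M).
    move=> s x y; rewrite inflation_scaleE linearP.
    rewrite -[LHS]/(factor_inj (s i) *: val (h x) + val (h y)).
    by rewrite -mul_factor_idem -scalerA componentP.
  by exists (mk_linear lh).
by rewrite -linearZ inflation_scaleE factor_injE scale1r.
Qed.

End Component.

(** * Reassembling a module from its components *)

Lemma sum_factor_idem (I : finType) (R : I -> comPzRingType) :
  \sum_i @factor_idem _ R i = 1.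
Proof.
apply/ffunP=> j; have -> : (\sum_i @factor_idem _ R i) j = \sum_i @factor_idem _ R i j.
  by apply: (big_morph (fun s : prod_ring R => s j)) => [s t|]; rewrite ffunE.
rewrite (bigD1 j) //= [in X in X + _]ffunE dfwith_in big1 ?addr0 ?ffunE // => i neq_ij.
by rewrite ffunE dfwith_out.
Qed.

Lemma factor_idem_orthogonal (I : finType) (R : I -> comPzRingType) i j :
  i != j -> @factor_idem _ R i * @factor_idem _ R j = 0.
Proof.
move=> neq_ij; apply/ffunP=> k; rewrite !ffunE.
have [<-|neq_ik] := eqVneq i k; last by rewrite dfwith_out // mul0r.
by rewrite [X in _ * X]dfwith_out 1?eq_sym // mulr0.
Qed.

(** The map x |-> e_i x is an isomorphism from N to the i-th component of its
   inflation, because e_i acts on the inflation as 1. *)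
Lemma component_of_inflation_SGP (I : finType) (R : I -> comPzRingType) i
    (N : lmodType (R i)) :
  strongly_Gorenstein_projective (component_functor R i (inflation_functor R i N)) ->
  strongly_Gorenstein_projective N.
Proof.
have ld : linear (fun x : N =>
    component_proj i (x : inflation N) : component i (inflation N)).
  move=> a x y; rewrite -{1}[a]factor_injE.
  rewrite -[_ *: x]/(factor_inj a *: (x : inflation N)) raddfD /=.
  by rewrite component_projZ factor_injE.
apply: (@SGP_of_iso _ _ _ (mk_linear ld)) => [x y /(congr1 val) /=|[y ey]].
  by rewrite !inflation_scaleE factor_injE !scale1r.
exists y; apply: val_inj => /=.
by move: ey => /eqP.
Qed.

(** The map x |-> (e_i x)_i is an isomorphism of S-modules from M to the direct
   sum of its inflated components: injective because the e_i add up to 1,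
   surjective because they are orthogonal. *)
Lemma decomposition_SGP (I : finType) (R : I -> comPzRingType)
    (M : lmodType (prod_ring R)) :
  (forall i, strongly_Gorenstein_projective (component_functor R i M)) ->
  strongly_Gorenstein_projective M.
Proof.
move=> sgpM.
pose V i : lmodType (prod_ring R) := inflation_functor R i (component_functor R i M).
have ld : linear (fun x : M => [ffun i => component_proj i x : V i] : dsum V).
  move=> s x y; apply/ffunP=> i; rewrite !ffunE raddfD /=.
  by rewrite component_projZ.
apply: (@SGP_of_iso _ _ _ (mk_linear ld)) => [x y /ffunP exy|y|].
- have eid i : @factor_idem _ R i *: x = @factor_idem _ R i *: y.
    by have /(congr1 val) := exy i; rewrite !ffunE.
  rewrite -[x]scale1r -[y]scale1r -(sum_factor_idem R) !scaler_suml.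
  by apply: eq_bigr => i _; apply: eid.
- exists (\sum_i val (y i : component i M)); apply/ffunP=> i; rewrite ffunE.
  apply: val_inj => /=; rewrite scaler_sumr (bigD1 i) //= componentP.
  rewrite big1 ?addr0 // => j neq_ji.
  by rewrite -[val _]componentP scalerA factor_idem_orthogonal ?scale0r // eq_sym.
apply: dsum_SGP => i; apply: biadjoint_SGP; last exact: sgpM.
- exact: inflation_component_adjoint.
exact: component_inflation_adjoint.
Qed.

Theorem theorem2p3 (m : nat) (hm : (1 <= m)%N) (R : 'I_m -> comPzRingType)
    (hR : forall i : 'I_m, finite_Ggldim (R i)) :
  SGP_eq_GP (prod_ring R) <-> forall i : 'I_m, SGP_eq_GP (R i).
Proof.
split=> [eqS i N|eqR M]; split; try exact: SGP_GP.
  move=> gpN; apply: component_of_inflation_SGP.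
  apply: biadjoint_SGP.
  - exact: component_inflation_adjoint.
  - exact: inflation_component_adjoint.
  apply/eqS; apply: biadjoint_GP gpN.
  - exact: inflation_component_adjoint.
  exact: component_inflation_adjoint.
move=> gpM; apply: decomposition_SGP => i; apply/eqR; apply: biadjoint_GP gpM.
- exact: component_inflation_adjoint.
exact: inflation_component_adjoint.
Qed.
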